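(* Let $(\mathcal{M},g,\overset{1}{\nabla})$ be a four-dimensional perfect fluid space-time with a semi-symmetric metric $P$-connection, $P$ unit timelike, which satisfies Einstein's field equations without the cosmological constant, $\overset{g}{Ric}-\frac{\overset{g}{r}}{2}g=k\tau$, with gravitational constant $k>0$ and energy-momentum tensor $\tau=p\,g+(\sigma+p)\,\pi\otimes\pi$. Then the strong energy condition is violated.
   Context: Setting: $(\mathcal{M},g)$ is a Lorentzian manifold of signature $(-,+,+,+)$ with Levi-Civita connection $\overset{g}{\nabla}$; $P$ is a vector field with $g(P,P)=-1$, and $\pi(\cdot)=g(\cdot,P)$. The connection $\overset{1}{\nabla}_XY=\overset{g}{\nabla}_XY+\pi(Y)X-g(X,Y)P$ is a semi-symmetric metric $P$-connection, i.e. $\overset{1}{\nabla}P=0$; equivalently $\overset{g}{\nabla}_XP=X+\pi(X)P$ for all $X$. Perfect fluid space-time means $\overset{g}{Ric}=a\,g+b\,\pi\otimes\pi$ for scalars $a,b$. Here $\overset{g}{Ric}(Y,Z)=\mathrm{tr}(X\mapsto\overset{g}{R}(X,Y)Z)$ with $\overset{g}{R}(X,Y)Z=\overset{g}{\nabla}_X\overset{g}{\nabla}_YZ-\overset{g}{\nabla}_Y\overset{g}{\nabla}_XZ-\overset{g}{\nabla}_{[X,Y]}Z$, and $\overset{g}{r}$ is the $g$-trace of $\overset{g}{Ric}$. The functions $\sigma$ (energy density) and $p$ (isotropic pressure) satisfy $\sigma+p\neq0$ and $\sigma>0$. The strong energy condition is the requirement that $\sigma+3p\ge0$ and $\sigma+p\ge0$.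 *)

(* Defs.v *)
From HB Require Import structures.
From mathcomp Require Import all_boot all_order all_algebra.
From mathcomp Require Import boolp classical_sets functions reals.
From mathcomp Require Import topology normedtype derive.
From mathcomp Require Import ring.

Set Implicit Arguments.
Unset Strict Implicit.
Unset Printing Implicit Defensive.

Import Order.TTheory GRing.Theory Num.Theory.
Import numFieldNormedType.Exports.

Local Open Scope classical_set_scope.
Local Open Scope ring_scope.

Definition partial (R : realType) (n : nat) (i : 'I_n) (f : 'rV[R]_n -> R) :
  'rV[R]_n -> R := fun y => 'D_'e_i f y.

(* The values of [f] outside of the open set [U] are irrelevant. *)
Fixpoint Ck (R : realType) (n : nat) (k : nat) (U : set 'rV[R]_n)
    (f : 'rV[R]_n -> R) : Prop :=
  (forall y, U y -> {for y, continuous f}) /\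
  if k is k'.+1 then
    forall i : 'I_n, (forall y, U y -> derivable f y 'e_i) /\
                     Ck k' U (partial i f)
  else True.

Definition smooth_on (R : realType) (n : nat) (U : set 'rV[R]_n)
  (f : 'rV[R]_n -> R) : Prop := forall k, Ck k U f.

(* [param] is the inverse of [coord] between [dom] and [coord @` dom]; both maps
   are total and carry no meaning elsewhere. *)
Record chart (R : realType) (n : nat) (T : topologicalType) := Chart {
  dom : set T ;
  coord : T -> 'rV[R]_n ;
  param : 'rV[R]_n -> T ;
  dom_open : open dom ;
  img_open : open (coord @` dom) ;
  coordK : forall x, dom x -> param (coord x) = x ;
  coord_cont : forall x, dom x -> {for x, continuous coord} ;
  param_cont : forall y, (coord @` dom) y -> {for y, continuous param} }.

Record smoothManifold (R : realType) (n : nat) := SmoothManifold {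
  carrier :> topologicalType ;
  atlas : set (chart R n carrier) ;
  manifold_hausdorff : hausdorff_space carrier ;
  manifold_second_countable : @second_countable carrier ;
  atlas_cover : forall x, exists2 c, atlas c & dom c x ;
  atlas_compat : forall c d, atlas c -> atlas d ->
    forall i : 'I_n,
      smooth_on (coord c @` (dom c `&` dom d))
                (fun y => coord d (param c y) 0 i) }.

Definition smooth (R : realType) (n : nat) (M : smoothManifold R n)
  (f : M -> R) : Prop :=
  forall c, atlas c -> smooth_on (coord c @` dom c) (f \o param c).

Section SmoothClosure.
Variables (R : realType) (n : nat).
Implicit Types (U : set 'rV[R]_n) (f g : 'rV[R]_n -> R).

Lemma Ck_cont k U f : Ck k U f -> forall y, U y -> {for y, continuous f}.
Proof. by case: k => [|k] []. Qed.

Lemma CkS k U f : Ck k.+1 U f -> Ck k U f.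
Proof.
elim: k f => [|k IH] f [cf df]; first by split.
by split=> // i; have [d1 d2] := df i; split=> //; apply: IH.
Qed.

Lemma Ck_eq k U f g : open U -> (forall y, U y -> f y = g y) ->
  Ck k U f -> Ck k U g.
Proof.
move=> oU.
have ne f' g' (y : 'rV[R]_n) : (forall z, U z -> f' z = g' z) -> U y ->
    \forall z \near y, f' z = g' z.
  by move=> fg Uy; near=> z; apply: fg; near: z; exact: open_nbhs_nbhs.
have cont f' g' : (forall z, U z -> f' z = g' z) ->
    (forall y, U y -> {for y, continuous f'}) ->
    forall y, U y -> {for y, continuous g'}.
  move=> fg cf y Uy; rewrite /prop_for /continuous_at -(fg _ Uy).
  have e := ne _ _ _ fg Uy.
  exact: cvg_trans (@near_eq_cvg _ _ (nbhs y) (nbhs_filter y) _ _ e) (cf y Uy).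
elim: k f g => [|k IH] f g fg [cf df]; split=> //; try exact: cont cf.
move=> i; have [d1 d2] := df i; split.
  by move=> y Uy; apply: near_eq_derivable (d1 y Uy); exact: ne.
by apply: IH d2 => y Uy; apply: near_eq_derive; exact: ne.
Unshelve. all: by end_near.
Qed.

Lemma Ck_cst k U (a : R) : open U -> Ck k U (cst a).
Proof.
move=> oU; elim: k a => [|k IH] a; split=> //; try by move=> y _; exact: cst_continuous.
move=> i; split=> [y _|]; first exact: derivable_cst.
by apply: Ck_eq (IH 0) => // y _; rewrite /partial derive_cst.
Qed.

Lemma Ck_scaleD k U (a : R) f g : open U ->
  Ck k U f -> Ck k U g -> Ck k U (fun y => a * f y + g y).
Proof.
move=> oU; elim: k f g => [|k IH] f g Cf Cg; split=> //;
    try (move=> y Uy; apply: (continuousD (V := R^o)); last exact: Ck_cont Cg y Uy;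
         apply: (continuousM (K := R)); [exact: cst_continuous | exact: Ck_cont Cf y Uy]).
move=> i; have [_ /(_ i)[f1 f2]] := Cf; have [_ /(_ i)[g1 g2]] := Cg.
split=> [y Uy|].
  by apply: derivableD (g1 y Uy); apply: derivableZ (f1 y Uy).
apply: Ck_eq (IH _ _ f2 g2) => // y Uy; rewrite /partial.
have /= -> := deriveD (derivableZ (k := a) (f1 y Uy)) (g1 y Uy).
by rewrite deriveZ //; exact: f1.
Qed.

Lemma Ck_mul k U f g : open U ->
  Ck k U f -> Ck k U g -> Ck k U (fun y => f y * g y).
Proof.
move=> oU; elim: k f g => [|k IH] f g Cf Cg; split=> //;
    try (move=> y Uy; apply: (continuousM (K := R)); [exact: Ck_cont Cf y Uy | exact: Ck_cont Cg y Uy]).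
move=> i; have [_ /(_ i)[f1 f2]] := Cf; have [_ /(_ i)[g1 g2]] := Cg.
split=> [y Uy|]; first exact: derivableM (f1 y Uy) (g1 y Uy).
have h := Ck_scaleD 1 oU (IH _ _ (CkS Cf) g2) (IH _ _ (CkS Cg) f2).
apply: Ck_eq h => // y Uy; rewrite /partial mul1r.
by have /= -> := deriveM (f1 y Uy) (g1 y Uy).
Qed.

Variable M : smoothManifold R n.

Lemma smooth_cst (a : R) : smooth (cst a : M -> R).
Proof. by move=> c _ k; apply: Ck_cst; exact: img_open. Qed.

Lemma smooth_scaleD (a : R) (f g : M -> R) :
  smooth f -> smooth g -> smooth (a *: f + g).
Proof.
move=> sf sg c Ac k.
exact (Ck_scaleD a (@img_open _ _ _ c) (sf c Ac k) (sg c Ac k)).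
Qed.

Lemma smooth_mul (f g : M -> R) : smooth f -> smooth g -> smooth (f * g).
Proof.
move=> sf sg c Ac k.
exact (Ck_mul (@img_open _ _ _ c) (sf c Ac k) (sg c Ac k)).
Qed.

End SmoothClosure.

Section Derivations.
Variables (R : realType) (n : nat) (M : smoothManifold R n).

(* The algebra C^oo(M) *)
Record cinf := Cinf { cinf_fun :> M -> R ; cinfP : smooth cinf_fun }.

Lemma cinf_eq (f g : cinf) : (forall x, f x = g x) -> f = g.
Proof.
case: f g => [f fP] [g gP] /= /funext fg; subst g.
by congr Cinf; exact: Prop_irrelevance.
Qed.

HB.instance Definition _ := gen_eqMixin cinf.
HB.instance Definition _ := gen_choiceMixin cinf.

Lemma cinf_scaleD_subproof (a : R) (f g : cinf) :
  smooth (fun x => a * f x + g x).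
Proof. exact: smooth_scaleD (cinfP f) (cinfP g). Qed.

Definition cinf_cst (a : R) : cinf := Cinf (smooth_cst a).
Definition cinf_scaleD (a : R) (f g : cinf) : cinf :=
  Cinf (cinf_scaleD_subproof a f g).

Lemma cinf_add_subproof (f g : cinf) : smooth (fun x => f x + g x).
Proof.
suff -> : (fun x => f x + g x) = cinf_scaleD 1 f g by exact: cinfP.
by apply/funext => x /=; rewrite mul1r.
Qed.

Lemma cinf_scale_subproof (a : R) (f : cinf) : smooth (fun x => a * f x).
Proof.
suff -> : (fun x => a * f x) = cinf_scaleD a f (cinf_cst 0) by exact: cinfP.
by apply/funext => x /=; rewrite addr0.
Qed.

Lemma cinf_opp_subproof (f : cinf) : smooth (fun x => - f x).
Proof.
suff -> : (fun x => - f x) = (fun x => -1 * f x) by exact: cinf_scale_subproof.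
by apply/funext => x; rewrite mulN1r.
Qed.

Lemma cinf_mul_subproof (f g : cinf) : smooth (fun x => f x * g x).
Proof. exact: smooth_mul (cinfP f) (cinfP g). Qed.

Definition cinf_add f g := Cinf (cinf_add_subproof f g).
Definition cinf_opp f := Cinf (cinf_opp_subproof f).
Definition cinf_mul f g := Cinf (cinf_mul_subproof f g).
Definition cinf_scale a f := Cinf (cinf_scale_subproof a f).

Lemma cinf_addA : associative cinf_add.
Proof. by move=> f g h; apply: cinf_eq => x /=; rewrite addrA. Qed.
Lemma cinf_addC : commutative cinf_add.
Proof. by move=> f g; apply: cinf_eq => x /=; rewrite addrC. Qed.
Lemma cinf_add0 : left_id (cinf_cst 0) cinf_add.
Proof. by move=> f; apply: cinf_eq => x /=; rewrite add0r. Qed.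
Lemma cinf_addN : left_inverse (cinf_cst 0) cinf_opp cinf_add.
Proof. by move=> f; apply: cinf_eq => x /=; rewrite addNr. Qed.

HB.instance Definition _ :=
  GRing.isZmodule.Build cinf cinf_addA cinf_addC cinf_add0 cinf_addN.

Lemma cinf_mulA : associative cinf_mul.
Proof. by move=> f g h; apply: cinf_eq => x /=; rewrite mulrA. Qed.
Lemma cinf_mulC : commutative cinf_mul.
Proof. by move=> f g; apply: cinf_eq => x /=; rewrite mulrC. Qed.
Lemma cinf_mul1 : left_id (cinf_cst 1) cinf_mul.
Proof. by move=> f; apply: cinf_eq => x /=; rewrite mul1r. Qed.
Lemma cinf_mulDl : left_distributive cinf_mul +%R.
Proof. by move=> f g h; apply: cinf_eq => x /=; rewrite mulrDl. Qed.

HB.instance Definition _ := GRing.Zmodule_isComPzRing.Build cinf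
  cinf_mulA cinf_mulC cinf_mul1 cinf_mulDl.

Lemma cinf_scaleA a b f :
  cinf_scale a (cinf_scale b f) = cinf_scale (a * b) f.
Proof. by apply: cinf_eq => x /=; rewrite mulrA. Qed.
Lemma cinf_scale1 : left_id 1 cinf_scale.
Proof. by move=> f; apply: cinf_eq => x /=; rewrite mul1r. Qed.
Lemma cinf_scaleDr : right_distributive cinf_scale +%R.
Proof. by move=> a f g; apply: cinf_eq => x /=; rewrite mulrDr. Qed.
Lemma cinf_scaleDl f : {morph cinf_scale^~ f : a b / a + b}.
Proof. by move=> a b; apply: cinf_eq => x /=; rewrite mulrDl. Qed.

HB.instance Definition _ := GRing.Zmodule_isLmodule.Build R cinf
  cinf_scaleA cinf_scale1 cinf_scaleDr cinf_scaleDl.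

Lemma cinf0E x : (0 : cinf) x = 0. Proof. by []. Qed.
Lemma cinfDE (f g : cinf) x : (f + g) x = f x + g x. Proof. by []. Qed.
Lemma cinfNE (f : cinf) x : (- f) x = - f x. Proof. by []. Qed.
Lemma cinfME (f g : cinf) x : (f * g) x = f x * g x. Proof. by []. Qed.
Lemma cinfZE (a : R) (f : cinf) x : (a *: f) x = a * f x. Proof. by []. Qed.

Definition point_derivation (x : M) (v : cinf -> R) : Prop :=
  (forall (a : R) f g, v (a *: f + g) = a * v f + v g) /\
  (forall f g, v (f * g) = v f * g x + f x * v g).

(* The tangent space T_x M, as derivations of C^oo(M) at x *)
Record tangent (x : M) := Tangent {
  tangent_fun :> cinf -> R ; tangentP : point_derivation x tangent_fun }.

Section TangentSpace.
Variable x : M.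
Implicit Types u v w : tangent x.

Lemma tangent_eq u v : (forall f, u f = v f) -> u = v.
Proof.
case: u v => [u uP] [v vP] /= /funext uv; subst v.
by congr Tangent; exact: Prop_irrelevance.
Qed.

HB.instance Definition _ := gen_eqMixin (tangent x).
HB.instance Definition _ := gen_choiceMixin (tangent x).

Lemma tangent0_subproof : point_derivation x (fun _ => 0).
Proof. by split=> *; ring. Qed.
Lemma tangent_add_subproof u v : point_derivation x (fun f => u f + v f).
Proof.
have [ul uM] := tangentP u; have [vl vM] := tangentP v.
by split=> *; rewrite ?ul ?vl ?uM ?vM; ring.
Qed.
Lemma tangent_opp_subproof u : point_derivation x (fun f => - u f).
Proof. by have [ul uM] := tangentP u; split=> *; rewrite ?ul ?uM; ring. Qed.
Lemma tangent_scale_subproof a u : point_derivation x (fun f => a * u f).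
Proof. by have [ul uM] := tangentP u; split=> *; rewrite ?ul ?uM; ring. Qed.

Definition tangent0 := Tangent tangent0_subproof.
Definition tangent_add u v := Tangent (tangent_add_subproof u v).
Definition tangent_opp u := Tangent (tangent_opp_subproof u).
Definition tangent_scale a u := Tangent (tangent_scale_subproof a u).

Lemma tangent_addA : associative tangent_add.
Proof. by move=> u v w; apply: tangent_eq => f /=; rewrite addrA. Qed.
Lemma tangent_addC : commutative tangent_add.
Proof. by move=> u v; apply: tangent_eq => f /=; rewrite addrC. Qed.
Lemma tangent_add0 : left_id tangent0 tangent_add.
Proof. by move=> u; apply: tangent_eq => f /=; rewrite add0r. Qed.
Lemma tangent_addN : left_inverse tangent0 tangent_opp tangent_add.
Proof. by move=> u; apply: tangent_eq => f /=; rewrite addNr. Qed.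

HB.instance Definition _ := GRing.isZmodule.Build (tangent x)
  tangent_addA tangent_addC tangent_add0 tangent_addN.

Lemma tangent_scaleA a b u :
  tangent_scale a (tangent_scale b u) = tangent_scale (a * b) u.
Proof. by apply: tangent_eq => f /=; rewrite mulrA. Qed.
Lemma tangent_scale1 : left_id 1 tangent_scale.
Proof. by move=> u; apply: tangent_eq => f /=; rewrite mul1r. Qed.
Lemma tangent_scaleDr : right_distributive tangent_scale +%R.
Proof. by move=> a u v; apply: tangent_eq => f /=; rewrite mulrDr. Qed.
Lemma tangent_scaleDl u : {morph tangent_scale^~ u : a b / a + b}.
Proof. by move=> a b; apply: tangent_eq => f /=; rewrite mulrDl. Qed.

HB.instance Definition _ := GRing.Zmodule_isLmodule.Build R (tangent x)
  tangent_scaleA tangent_scale1 tangent_scaleDr tangent_scaleDl.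

End TangentSpace.

Definition derivation (X : cinf -> cinf) : Prop :=
  (forall (a : R) f g, X (a *: f + g) = a *: X f + X g) /\
  (forall f g, X (f * g) = X f * g + f * X g).

(* The smooth vector fields, as derivations of C^oo(M); [X f] is the derivative
   of [f] along [X]. *)
Record vfield := VField {
  vfield_fun :> cinf -> cinf ; vfieldP : derivation vfield_fun }.

Implicit Types X Y Z : vfield.

Lemma vfield_eq X Y : (forall f x, X f x = Y f x) -> X = Y.
Proof.
case: X Y => [X XP] [Y YP] /= XY.
have {}XY : X = Y by apply/funext => f; apply: cinf_eq.
by subst Y; congr VField; exact: Prop_irrelevance.
Qed.

HB.instance Definition _ := gen_eqMixin vfield.
HB.instance Definition _ := gen_choiceMixin vfield.

Lemma vfield0_subproof : derivation (fun _ => 0).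
Proof.
by split=> *; apply: cinf_eq => x; rewrite !(cinfDE, cinfZE, cinfME, cinf0E); ring.
Qed.
Lemma vfield_add_subproof X Y : derivation (fun f => X f + Y f).
Proof.
have [Xl XM] := vfieldP X; have [Yl YM] := vfieldP Y.
split=> *; apply: cinf_eq => x; rewrite ?Xl ?Yl ?XM ?YM.
  by rewrite !(cinfDE, cinfZE); ring.
by rewrite !(cinfDE, cinfME); ring.
Qed.
Lemma vfield_opp_subproof X : derivation (fun f => - X f).
Proof.
have [Xl XM] := vfieldP X; split=> *; apply: cinf_eq => x; rewrite ?Xl ?XM.
  by rewrite !(cinfNE, cinfDE, cinfZE); ring.
by rewrite !(cinfDE, cinfNE, cinfME); ring.
Qed.
Lemma vfield_scale_subproof (h : cinf) X : derivation (fun f => h * X f).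
Proof.
have [Xl XM] := vfieldP X; split=> *; apply: cinf_eq => x; rewrite ?Xl ?XM.
  by rewrite !(cinfME, cinfDE, cinfZE); ring.
by rewrite !(cinfME, cinfDE); ring.
Qed.
Lemma bracket_subproof X Y : derivation (fun f => X (Y f) - Y (X f)).
Proof.
have [Xl XM] := vfieldP X; have [Yl YM] := vfieldP Y.
have Dl Z f g : Z (f + g) = Z f + Z g.
  by have [Zl _] := vfieldP Z; have := Zl 1 f g; rewrite !scale1r.
split=> [a f g|f g]; apply: cinf_eq => x.
  by rewrite Yl Xl Xl Yl !(cinfDE, cinfNE, cinfZE); ring.
by rewrite YM XM !Dl !XM !YM !(cinfDE, cinfNE, cinfME); ring.
Qed.

Definition vfield0 := VField vfield0_subproof.
Definition vfield_add X Y := VField (vfield_add_subproof X Y).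
Definition vfield_opp X := VField (vfield_opp_subproof X).
Definition vfield_scale h X := VField (vfield_scale_subproof h X).
Definition bracket X Y := VField (bracket_subproof X Y).

Lemma vfield_addA : associative vfield_add.
Proof. by move=> X Y Z; apply: vfield_eq => f x /=; rewrite addrA. Qed.
Lemma vfield_addC : commutative vfield_add.
Proof. by move=> X Y; apply: vfield_eq => f x /=; rewrite addrC. Qed.
Lemma vfield_add0 : left_id vfield0 vfield_add.
Proof. by move=> X; apply: vfield_eq => f x /=; rewrite add0r. Qed.
Lemma vfield_addN : left_inverse vfield0 vfield_opp vfield_add.
Proof. by move=> X; apply: vfield_eq => f x /=; rewrite addNr. Qed.

HB.instance Definition _ := GRing.isZmodule.Build vfield
  vfield_addA vfield_addC vfield_add0 vfield_addN.

Lemma vfield_scaleA h k X :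
  vfield_scale h (vfield_scale k X) = vfield_scale (h * k) X.
Proof. by apply: vfield_eq => f x /=; rewrite mulrA. Qed.
Lemma vfield_scale1 : left_id 1 vfield_scale.
Proof. by move=> X; apply: vfield_eq => f x /=; rewrite mul1r. Qed.
Lemma vfield_scaleDr : right_distributive vfield_scale +%R.
Proof. by move=> h X Y; apply: vfield_eq => f x /=; rewrite mulrDr. Qed.
Lemma vfield_scaleDl X : {morph vfield_scale^~ X : h k / h + k}.
Proof. by move=> h k; apply: vfield_eq => f x /=; rewrite mulrDl. Qed.

HB.instance Definition _ := GRing.Zmodule_isLmodule.Build cinf vfield
  vfield_scaleA vfield_scale1 vfield_scaleDr vfield_scaleDl.

Lemma vfieldDE X Y f x : (X + Y) f x = X f x + Y f x. Proof. by []. Qed.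
Lemma vfieldNE X f x : (- X) f x = - X f x. Proof. by []. Qed.
Lemma vfieldZE (h : cinf) X f x : (h *: X) f x = h x * X f x.
Proof. by []. Qed.

Lemma value_subproof X (x : M) : point_derivation x (fun f => X f x).
Proof.
have [Xl XM] := vfieldP X; split=> *.
  by rewrite Xl cinfDE cinfZE.
by rewrite XM cinfDE !cinfME.
Qed.

Definition value X (x : M) : tangent x := Tangent (value_subproof X x).

(* [E] is a frame at [x]: the vectors E_i(x) form a basis of T_x M. Since vector
   fields can be cut off, every basis of T_x M arises from global fields. *)
Definition frame_at (x : M) (E : 'I_n -> vfield) : Prop :=
  forall v : tangent x, exists! c : 'rV[R]_n, v = \sum_i c 0 i *: value (E i) x.

(* The trace at [x] of a C^oo(M)-linear map [A], read off from the matrix [a] of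
   the endomorphism of T_x M that it induces in a frame; [xget] picks a value,
   and 0 is a junk value for the case of an empty set. *)
Definition trace_at (x : M) (A : vfield -> vfield) : R :=
  xget 0 [set t | exists (E : 'I_n -> vfield) (a : 'M[R]_n),
    [/\ frame_at x E,
        forall j, value (A (E j)) x = \sum_i a i j *: value (E i) x
      & t = \tr a]].

Record lorentzMetric := LorentzMetric {
  lm_form : forall x : M, tangent x -> tangent x -> R ;
  lm_linear : forall x (a : R) (u v w : tangent x),
    lm_form (a *: u + v) w = a * lm_form u w + lm_form v w ;
  lm_sym : forall x (u v : tangent x), lm_form u v = lm_form v u ;
  lm_smooth : forall X Y : vfield,
    smooth (fun x => lm_form (value X x) (value Y x)) ;
  (* signature (-,+,...,+) *)
  lm_signature : forall x, exists2 E : 'I_n -> vfield, frame_at x E &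
    forall i j, lm_form (value (E i) x) (value (E j) x) =
      if i == j then if i == 0%N :> nat then -1 else 1 else 0 }.

Definition inner (g : lorentzMetric) (X Y : vfield) : cinf :=
  Cinf (lm_smooth g X Y).

(* The trace g^{ij} B_{ij} of a bilinear form [B] with respect to [g]. *)
Definition metric_trace (g : lorentzMetric) (B : vfield -> vfield -> M -> R)
    (x : M) : R :=
  xget 0 [set t | exists2 E : 'I_n -> vfield, frame_at x E &
    t = \tr (invmx (\matrix_(i, j) inner g (E i) (E j) x) *m
             \matrix_(i, j) B (E i) (E j) x)].

Record affine_connection (nabla : vfield -> vfield -> vfield) : Prop := {
  conn_linear : forall (f : cinf) X X' Y,
    nabla (f *: X + X') Y = f *: nabla X Y + nabla X' Y ;
  conn_add : forall X Y Y', nabla X (Y + Y') = nabla X Y + nabla X Y' ;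
  conn_leibniz : forall X (f : cinf) Y,
    nabla X (f *: Y) = X f *: Y + f *: nabla X Y }.

Record levi_civita (g : lorentzMetric) (nabla : vfield -> vfield -> vfield) :
    Prop := {
  lc_conn : affine_connection nabla ;
  lc_torsion_free : forall X Y, nabla X Y - nabla Y X = bracket X Y ;
  lc_metric : forall X Y Z,
    X (inner g Y Z) = inner g (nabla X Y) Z + inner g Y (nabla X Z) }.

Definition curvature (nabla : vfield -> vfield -> vfield) (X Y Z : vfield) :
    vfield :=
  nabla X (nabla Y Z) - nabla Y (nabla X Z) - nabla (bracket X Y) Z.

Definition ricci (nabla : vfield -> vfield -> vfield) (Y Z : vfield) (x : M) : R :=
  trace_at x (fun X => curvature nabla X Y Z).

Definition scalar_curvature (g : lorentzMetric)
    (nabla : vfield -> vfield -> vfield) (x : M) : R :=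
  metric_trace g (ricci nabla) x.

Definition dual_form (g : lorentzMetric) (P X : vfield) : cinf := inner g X P.

Definition semi_symmetric_metric (g : lorentzMetric)
    (nabla : vfield -> vfield -> vfield) (P X Y : vfield) : vfield :=
  nabla X Y + dual_form g P Y *: X - inner g X Y *: P.

Definition P_connection (D : vfield -> vfield -> vfield) (P : vfield) : Prop :=
  forall X, D X P = 0.

Definition perfect_fluid (g : lorentzMetric)
    (nabla : vfield -> vfield -> vfield) (P : vfield) : Prop :=
  exists a b : cinf, forall Y Z x,
    ricci nabla Y Z x =
      a x * inner g Y Z x + b x * (dual_form g P Y x * dual_form g P Z x).

Definition energy_momentum (g : lorentzMetric) (P : vfield) (sigma p : cinf)
    (Y Z : vfield) : cinf :=
  p * inner g Y Z + (sigma + p) * (dual_form g P Y * dual_form g P Z).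

Definition einstein_equations (g : lorentzMetric)
    (nabla : vfield -> vfield -> vfield) (k : R) (tau : vfield -> vfield -> cinf) :
    Prop :=
  forall Y Z x,
    ricci nabla Y Z x - scalar_curvature g nabla x / 2 * inner g Y Z x =
      k * tau Y Z x.

Definition strong_energy_condition (sigma p : cinf) (x : M) : Prop :=
  0 <= sigma x + 3 * p x /\ 0 <= sigma x + p x.

End Derivations.

(* Main.v *)
Require Import Defs.
From mathcomp Require Import all_boot all_order all_algebra.
From mathcomp Require Import boolp classical_sets functions reals.
From mathcomp Require Import topology normedtype derive.
From mathcomp Require Import ring lra.
Import Order.TTheory GRing.Theory Num.Theory.
Import numFieldNormedType.Exports.
Local Open Scope ring_scope.

(** The condition [D P = 0] for the semi-symmetric connection [D] says that
    the Levi-Civita derivative of [P] is the projection orthogonal to [P],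
    [nabla X P = X + pi(X) P].  Differentiating once more, and using that the
    bilinear form [g (nabla X P) Y = g X Y + pi(X) pi(Y)] is symmetric (so that
    [pi] is closed), the curvature satisfies [R(X,Y)P = pi(Y) X - pi(X) Y]
    ([curvature_torse_forming]).  The trace over [X] is [(n-1) pi(Y)], hence
    [Ric(P,P) = - (n-1)] ([ricci_torse_forming]): the geometry makes gravity
    repulsive along [P].

    In dimension 4 the field equations turn this into a statement on the fluid.
    Their [g]-trace is [r = k (sigma - 3 p)] and their value on [(P,P)] is
    [-3 + r/2 = k sigma]; eliminating [r] yields [k (sigma + 3 p) = -6],
    so [sigma + 3 p < 0] everywhere.

    Traces are defined by choosing a frame, so both of them are computed in an
    arbitrary frame.  For the metric trace this requires the Gram matrix of any
    frame to be invertible, which is the nondegeneracy of [g] read off from the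
    orthonormal frame ([gram_unitmx]). *)

(** * The metric as a bilinear form *)

Section Metric.
Context {R : realType} {n : nat} {M : smoothManifold R n} (g : lorentzMetric M).

Section AtPoint.
Context {x : M}.
Implicit Types u v w : tangent x.

Lemma lm_formDl u v w : lm_form g (u + v) w = lm_form g u w + lm_form g v w.
Proof. by have := lm_linear g 1 u v w; rewrite scale1r mul1r. Qed.

Lemma lm_form0l w : lm_form g 0 w = 0.
Proof. by have /eqP := lm_formDl 0 0 w; rewrite addr0 -subr_eq subrr => /eqP. Qed.

Lemma lm_formZl a u w : lm_form g (a *: u) w = a * lm_form g u w.
Proof. by have := lm_linear g a u 0 w; rewrite !addr0 lm_form0l addr0. Qed.

Lemma lm_form_suml (I : finType) (c : I -> R) (u : I -> tangent x) w :
  lm_form g (\sum_i c i *: u i) w = \sum_i c i * lm_form g (u i) w.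
Proof.
rewrite (big_morph (fun u => lm_form g u w) (fun u v => lm_formDl u v w)
  (lm_form0l w)).
by apply: eq_bigr => i _; exact: lm_formZl.
Qed.

Lemma frame_coord {E : 'I_n -> vfield M} (frE : frame_at x E) v :
  exists c : 'rV[R]_n, v = \sum_i c 0 i *: value (E i) x.
Proof. by have [c [-> _]] := frE v; exists c. Qed.

Lemma frame_coord_inj {E : 'I_n -> vfield M} {c d : 'rV[R]_n} :
  frame_at x E ->
  \sum_i c 0 i *: value (E i) x = \sum_i d 0 i *: value (E i) x -> c = d.
Proof.
move=> /(_ (\sum_i c 0 i *: value (E i) x))[e [_ eu]] cd.
by rewrite -(eu c erefl) -(eu d cd).
Qed.

(** In an orthonormal frame the products with the frame vectors are the
    coordinates up to sign. *)
Lemma lm_form_nondegenerate v : (forall w, lm_form g v w = 0) -> v = 0.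
Proof.
move=> v0; have [F frF oF] := lm_signature g x.
have [d vE] := frame_coord frF v.
rewrite vE big1 // => j _.
have := v0 (value (F j) x); rewrite {1}vE lm_form_suml (bigD1 j) //=.
rewrite big1 => [|i /negPf ij]; last by rewrite oF ij mulr0.
rewrite oF eqxx addr0 => /eqP; rewrite mulf_eq0 => /orP[/eqP->|].
  by rewrite scale0r.
by case: ifP; rewrite ?oppr_eq0 oner_eq0.
Qed.

(** * Traces in an arbitrary frame *)

Definition gram (E : 'I_n -> vfield M) : 'M[R]_n :=
  \matrix_(i, j) inner g (E i) (E j) x.

Lemma gram_mul (E : 'I_n -> vfield M) (c : 'rV[R]_n) j :
  (c *m gram E) 0 j = lm_form g (\sum_i c 0 i *: value (E i) x) (value (E j) x).
Proof. by rewrite mxE lm_form_suml; apply: eq_bigr => i _; rewrite mxE. Qed.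

(** A row vector killed by the Gram matrix holds the coordinates of a vector
    orthogonal to the whole frame. *)
Lemma gram_unitmx (E : 'I_n -> vfield M) : frame_at x E -> gram E \in unitmx.
Proof.
move=> frE; rewrite -row_free_unit -kermx_eq0; apply/eqP/row_matrixP => k.
rewrite row0; set c := row k _.
have c0 : c *m gram E = 0 by rewrite -row_mul mulmx_ker row0.
apply: (frame_coord_inj frE).
rewrite [RHS]big1 => [|i _]; last by rewrite mxE scale0r.
apply: lm_form_nondegenerate => w; have [d ->] := frame_coord frE w.
rewrite lm_sym lm_form_suml big1 // => j _.
by rewrite lm_sym -gram_mul c0 mxE mulr0.
Qed.

(** On the tangent space [A] induces [a] times the identity minus a map of rank
    one, whose trace is the pairing of its two factors. *)
Lemma trace_at_scale_sub_rank_one (A : vfield M -> vfield M) (a : R) v w :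
  (forall X, value (A X) x =
     a *: value X x - lm_form g (value X x) w *: v) ->
  trace_at x A = n%:R * a - lm_form g v w.
Proof.
move=> AE.
have Amx (E : 'I_n -> vfield M) : frame_at x E -> exists2 m : 'M[R]_n,
    forall j, value (A (E j)) x = \sum_i m i j *: value (E i) x
  & \tr m = n%:R * a - lm_form g v w.
  move=> frE; have [c vE] := frame_coord frE v.
  exists (a%:M - \matrix_(i, j) (c 0 i * lm_form g (value (E j) x) w)).
    move=> j; rewrite AE {1}vE scaler_sumr.
    rewrite [a *: _](_ : _ = \sum_i (a *+ (i == j)) *: value (E i) x).
      rewrite -sumrB; apply: eq_bigr => i _.
      by rewrite !mxE scalerBl scalerA [in RHS]mulrC.
    by rewrite (bigD1 j) //= eqxx big1 ?addr0 // => i /negPf->; rewrite scale0r.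
  rewrite linearB /= mxtrace_scalar mulr_natl; congr (_ - _).
  by rewrite vE lm_form_suml; apply: eq_bigr => i _; rewrite mxE.
apply: xget_unique => /=.
  have [E frE _] := lm_signature g x; have [m mE <-] := Amx E frE.
  by exists E, m.
move=> t [E [m [frE mE ->]]]; have [m' m'E <-] := Amx E frE.
congr (\tr _); apply/matrixP => i j.
have : \row_i m i j = \row_i m' i j.
  apply: (frame_coord_inj frE); under eq_bigr do rewrite mxE.
  by under [RHS]eq_bigr do rewrite mxE; rewrite -mE.
by move=> /rowP/(_ i); rewrite !mxE.
Qed.

(** In a frame with Gram matrix [G], where [w] has the row of coordinates [c],
    the form [B] has the matrix [a G + b (c G)^T (c G)].  Multiplied by [G^-1] it
    becomes [a 1 + b c^T c G], and [c^T c G] has trace [c G c^T = g(w,w)]. *)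
Lemma metric_trace_scale_add_rank_one (B : vfield M -> vfield M -> M -> R)
    (a b : R) w :
  (forall X Y, B X Y x = a * inner g X Y x +
     b * (lm_form g (value X x) w * lm_form g (value Y x) w)) ->
  metric_trace g B x = n%:R * a + b * lm_form g w w.
Proof.
move=> BE.
have trB (E : 'I_n -> vfield M) : frame_at x E ->
    \tr (invmx (gram E) *m \matrix_(i, j) B (E i) (E j) x) =
    n%:R * a + b * lm_form g w w.
  move=> frE; have [c wE] := frame_coord frE w.
  have Gu := gram_unitmx E frE.
  have cG j : (c *m gram E) 0 j = lm_form g (value (E j) x) w.
    by rewrite gram_mul -wE lm_sym.
  have Gsym : (gram E)^T = gram E.
    by apply/matrixP => i j; rewrite !mxE /= lm_sym.
  have -> : \matrix_(i, j) B (E i) (E j) x =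
      a *: gram E + b *: ((c *m gram E)^T *m (c *m gram E)).
    apply/matrixP => i j; rewrite mxE BE -!cG [RHS]mxE; congr (_ + _).
      by rewrite [RHS]mxE; congr (_ * _); rewrite mxE.
    by rewrite [RHS]mxE [(_ *m _) i j]mxE big_ord1 [_^T _ _]mxE.
  rewrite trmx_mul Gsym mulmxDr -!scalemxAr mulVmx // !mulmxA mulVmx // mul1mx.
  rewrite linearD !linearZ /= mxtrace1 mulrC; congr (_ + b * _).
  rewrite -mulmxA mxtrace_mulC trace_mx11 [LHS]mxE {1}wE lm_form_suml.
  by apply: eq_bigr => j _; rewrite cG mxE mulrC.
apply: xget_unique => /=.
  by have [E frE _] := lm_signature g x; exists E => //; rewrite trB.
by move=> t [E frE ->]; rewrite trB.
Qed.

End AtPoint.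

Lemma innerDl X Y Z y : inner g (X + Y) Z y = inner g X Z y + inner g Y Z y.
Proof.
rewrite /= -lm_formDl; congr (lm_form g _ _); exact: tangent_eq.
Qed.

Lemma innerZl (f : cinf M) X Z y : inner g (f *: X) Z y = f y * inner g X Z y.
Proof.
rewrite /= -lm_formZl; congr (lm_form g _ _); exact: tangent_eq.
Qed.

Lemma innerNl X Z y : inner g (- X) Z y = - inner g X Z y.
Proof. by rewrite -scaleN1r innerZl cinfNE mulN1r. Qed.

Lemma innerC X Y : inner g X Y = inner g Y X.
Proof. by apply: cinf_eq => y /=; rewrite lm_sym. Qed.

(** * Curvature along a parallel field of a semi-symmetric connection *)

Variables (nabla : vfield M -> vfield M -> vfield M) (P : vfield M).
Hypotheses (nabla_lc : levi_civita g nabla)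
  (P_unit : forall y, inner g P P y = -1)
  (P_conn : P_connection (semi_symmetric_metric g nabla P) P).

Lemma torse_forming X : nabla X P = X + inner g X P *: P.
Proof.
have PP : inner g P P = -1 by apply: cinf_eq => y; rewrite P_unit.
have := P_conn X; rewrite /semi_symmetric_metric /dual_form PP scaleN1r.
by move/eqP; rewrite subr_eq add0r subr_eq addrC => /eqP.
Qed.

(** The terms along [P] cancel because [g (nabla X P) Y] is symmetric in [X] and
    [Y], that is, because [pi] is closed. *)
Lemma curvature_torse_forming X Y :
  curvature nabla X Y P = inner g Y P *: X - inner g X P *: Y.
Proof.
have [[_ connD connM] tors met] := nabla_lc.
have dpi (Z W : vfield M) y : Z (inner g W P) y = inner g (nabla Z W) P y + inner g Z W y +
    inner g Z P y * inner g W P y.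
  by rewrite met cinfDE (innerC W) torse_forming innerDl innerZl (innerC P W) addrA.
rewrite /curvature (torse_forming Y) (torse_forming X) !connD !connM.
rewrite !torse_forming -tors; apply: vfield_eq => f y.
rewrite !(vfieldDE, vfieldNE, vfieldZE, innerDl, innerNl, dpi).
by rewrite (innerC Y X); ring.
Qed.

Lemma ricci_torse_forming x : ricci nabla P P x = 1 - n%:R.
Proof.
rewrite /ricci (@trace_at_scale_sub_rank_one x _ (-1) (value P x) (value P x)).
  by have /= -> := P_unit x; ring.
move=> X; apply: tangent_eq => f.
by rewrite curvature_torse_forming /=; have /= -> := P_unit x; ring.
Qed.

End Metric.

Theorem theorem6p5 (R : realType) (M : smoothManifold R 4)
    (g : lorentzMetric M) (nabla : vfield M -> vfield M -> vfield M)
    (P : vfield M) (sigma p : cinf M) (k : R)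
    (nabla_lc : levi_civita g nabla)
    (P_unit : forall x : M, inner g P P x = -1)
    (P_conn : P_connection (semi_symmetric_metric g nabla P) P)
    (fluid : perfect_fluid g nabla P)
    (k_gt0 : 0 < k)
    (sigma_p_neq0 : forall x : M, sigma x + p x != 0)
    (sigma_gt0 : forall x : M, 0 < sigma x)
    (einstein : einstein_equations g nabla k (energy_momentum g P sigma p)) :
  forall x : M, ~ strong_energy_condition sigma p x.
Proof.
move=> x [sec _].
(* The metric trace of the field equations, solved for the Ricci tensor, relates
   r to sigma and p. *)
have ricE Y Z : ricci nabla Y Z x =
    (scalar_curvature g nabla x / 2 + k * p x) * inner g Y Z x +
    k * (sigma x + p x) * (inner g Y P x * inner g Z P x).
  have /eqP := einstein Y Z x; rewrite subr_eq => /eqP->.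
  by rewrite /energy_momentum /dual_form !(cinfDE, cinfME); ring.
have rE := @metric_trace_scale_add_rank_one _ _ _ g x _ _ _ (value P x) ricE.
have /= PP := P_unit x; rewrite PP -/(scalar_curvature g nabla x) in rE.
have ricPP := ricci_torse_forming g nabla P nabla_lc P_unit P_conn x.
rewrite ricE P_unit in ricPP.
have : k * (sigma x + 3 * p x) = -6 by move: rE ricPP; lra.
have := mulr_ge0 (ltW k_gt0) sec; lra.
Qed.
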